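(* Let $b\geqslant 2$ be an integer. The sets ${\cal Q}_{\mathrm{WCP}}$ and ${\cal Q}_{\mathrm{DC}}$, equipped with the addition induced on equivalence classes by the formulas given in the context, are abelian groups.
   Context: Words. Let $\beta=b-1$ and let ${\cal A}=\{0,1,\ldots,\beta\}$ be the alphabet. For a nonempty finite word $W=w_0\cdots w_{\ell-1}$ on ${\cal A}$, $|W|=\ell$ is its length and $N(W)=\sum_{i<\ell}w_ib^{\ell-1-i}$ the integer it writes in base $b$; $W^k$ is the concatenation of $k$ copies of $W$. A circular word $\widetilde{P}$ of length $\ell$ is a word $p_0\cdots p_{\ell-1}$ on ${\cal A}$ with letters indexed by $\mathbb{Z}/\ell\mathbb{Z}$ (with a marked initial letter $p_0$); $P$ denotes the corresponding finite word. The shift is $\sigma(\widetilde{p_0p_1\cdots p_{\ell-1}})=\widetilde{p_1\cdots p_{\ell-1}p_0}$. $\mathbb{D}_b=\{u b^e: u,e\in\mathbb{Z}\}\subset\mathbb{Q}$. Circular words of length $\ell$ are identified with integers in $[0,b^\ell-1]$ through $\widetilde{P}\mapsto N(P)$; words $W$ are written for $N(W)$ when used as integers, and $W+1$ denotes a word writing the integer $N(W)+1$. For an integer $M$, $q_\ell(M)$ and $r_\ell(M)$ are the quotient and remainder ($0\leqslant r_\ell(M)<b^\ell-1$) of the Euclidean division of $M$ by $b^\ell-1$; remainders are viewed as circular words of length $\ell$. The set ${\cal Q}_{\mathrm{WCP}}$: the set of quadruples $(s,W,\widetilde{P},c)$, with $s\in\{+,-\}$, $W$ a finite word, $\widetilde{P}$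 a circular word, $c\in\mathbb{Z}$, modulo the equivalence relation generated by: $(s,W,\widetilde{P},c)\equiv(s,0W,\widetilde{P},c)$; $(s,W,\widetilde{P},c)\equiv(s,W,\widetilde{P^k},c)$ for all $k\geqslant 1$; $(s,W,\widetilde{\beta},c)\equiv(s,W+1,\widetilde{0},c)$; $(s,W,\widetilde{P},c)\equiv(s,Wp_0,\sigma(\widetilde{P}),c-1)$ where $p_0$ is the initial letter of $\widetilde{P}$; and $(+,0,\widetilde{0},c)\equiv(-,0,\widetilde{0},c)$. The set ${\cal Q}_{\mathrm{DC}}$: the set of pairs $(\delta,\widetilde{P})$, with $\delta\in\mathbb{D}_b$ and $\widetilde{P}$ a circular word, modulo the equivalence relation generated by $(\delta,\widetilde{P})\equiv(\delta,\widetilde{P^k})$ for $k\geqslant1$ and $(\delta,\widetilde{\beta})\equiv(\delta+1,\widetilde{0})$. Addition. By the identifications one may take representatives whose circular words have a common length $\ell$ and (for WCP) with a common value of $c$. Then $(\delta,\widetilde{P})+(\delta',\widetilde{P'})=(\delta+\delta'+q_\ell(P+P'),\ r_\ell(P+P'))$ and, for equal signs, $(s,W,\widetilde{P},c)+(s,W',\widetilde{P'},c)=(s,W+W'+q_\ell(P+P'),\ r_\ell(P+P'),\ c)$. For opposite signs, with representatives whose circular words are not of the form $\widetilde{\beta^\ell}$: $(+,W,\widetilde{P},c)+(-,W',\widetilde{P'},c)$ equals $(+,W-W',r_\ell(P-P'),c)$ if $W\geqslant W'$ and $P\geqslant P'$; equals $(+,W-W'-1,r_\ell(P-P'),c)$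 if $W>W'$ and $P<P'$; equals $(-,0,r_\ell(P'-P),c)$ if $W=W'$ and $P<P'$; in the remaining cases ($W<W'$) it is obtained by exchanging the roles of $(W,\widetilde P)$ and $(W',\widetilde{P'})$ and reversing the sign of the result; and addition is commutative. *)

(* Defs.v *)
From mathcomp Require Import all_boot all_order all_algebra.
From mathcomp Require Import boolp.
From Stdlib Require Import Relations.Relation_Operators.

Set Implicit Arguments.
Unset Strict Implicit.
Unset Printing Implicit Defensive.

Import Order.TTheory GRing.Theory Num.Theory.
Local Open Scope ring_scope.
Local Open Scope quotient_scope.

Section GeneratedQuotient.
Variables (T : choiceType) (step : T -> T -> Prop).

Definition gen_rel : rel T := fun x y => `[< clos_refl_sym_trans T step x y >].

Lemma gen_rel_refl : reflexive gen_rel.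
Proof. by move=> x; apply/asboolP; apply: rst_refl. Qed.

Lemma gen_rel_sym : symmetric gen_rel.
Proof.
by move=> x y; apply/asboolP/asboolP => h; apply: rst_sym.
Qed.

Lemma gen_rel_trans : transitive gen_rel.
Proof.
move=> y x z /asboolP xy /asboolP yz; apply/asboolP.
exact: rst_trans xy yz.
Qed.

Definition gen_equiv : equiv_rel T :=
  EquivRel gen_rel gen_rel_refl gen_rel_sym gen_rel_trans.

Definition gen_quot := {eq_quot gen_equiv}.

Definition class_of (x : T) : gen_quot := \pi_({eq_quot gen_equiv}) x.

(* [rule x y z] reads "the formula, applicable to the representatives x and y,
   returns z"; the first conjunct is independence of the representatives, the
   second says that any two classes have representatives to which the formula
   applies. Together they determine [add]. *)
Definition induced_by (rule : T -> T -> T -> Prop)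
    (add : gen_quot -> gen_quot -> gen_quot) : Prop :=
  (forall x y z, rule x y z ->
     add (class_of x) (class_of y) = class_of z) /\
  (forall u v, exists x y z,
     [/\ u = class_of x, v = class_of y & rule x y z]).

End GeneratedQuotient.

Definition abelian_group (G : Type) (add : G -> G -> G) : Prop :=
  exists (zero : G) (opp : G -> G),
    [/\ associative add, commutative add, left_id zero add
      & left_inverse zero opp add].

Section Words.
Variable b : nat.

(* Nonempty words on {0, .., b-1}. A circular word with marked initial letter
   is represented by the finite word read from that letter, so the same type
   serves for both; the shift is [rot 1]. *)
Definition word := {w : seq 'I_b | w != [::]}.

Definition len (W : word) : nat := size (val W).

Definition N (W : word) : nat :=
  (\sum_(i < size (val W))
     tnth (in_tuple (val W)) i * b ^ (size (val W) - 1 - i))%N.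

Definition is_letter (W : word) (a : nat) : Prop :=
  exists2 x : 'I_b, val W = [:: x] & x = a :> nat.

Definition is_power (P' P : word) (k : nat) : Prop :=
  val P' = flatten (nseq k (val P)).

Definition all_beta (P : word) : bool :=
  all (fun x : 'I_b => x == b.-1 :> nat) (val P).

Definition quo (l : nat) (M : int) : int := (M %/ ((b ^ l)%:Z - 1))%Z.

Definition is_rem (R : word) (l : nat) (M : int) : Prop :=
  len R = l /\ (N R)%:Z = (M %% ((b ^ l)%:Z - 1))%Z.

(* Quadruples (s, W, P, c); the sign s is [true] for + and [false] for -. *)
Definition wcp := (bool * word * word * int)%type.

Inductive wcp_step : wcp -> wcp -> Prop :=
| wcp_lead s (W W' P : word) c (z : 'I_b) of
    z = 0%N :> nat & val W' = z :: val W :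
    wcp_step (s, W, P, c) (s, W', P, c)
| wcp_pow s (W P P' : word) c k of (1 <= k)%N & is_power P' P k :
    wcp_step (s, W, P, c) (s, W, P', c)
| wcp_beta s (W V P Z : word) c of
    is_letter P b.-1 & is_letter Z 0 & N V = (N W + 1)%N :
    wcp_step (s, W, P, c) (s, V, Z, c)
| wcp_shift s (W W' P P' : word) c (p0 : 'I_b) p of
    val P = p0 :: p & val W' = rcons (val W) p0 & val P' = rot 1 (val P) :
    wcp_step (s, W, P, c) (s, W', P', c - 1)
| wcp_sign (Z : word) c of is_letter Z 0 :
    wcp_step (true, Z, Z, c) (false, Z, Z, c).

Definition Q_WCP := gen_quot wcp_step.

(* The difference (+, W, P) + (-, W', P') for W >= W', with result (s, V, R). *)
Inductive wcp_diff (W P W' P' : word) : bool -> word -> word -> Prop :=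
| wcp_diff_ge V R of
    (N W' <= N W)%N & (N P' <= N P)%N &
    N V = (N W - N W')%N & is_rem R (len P) ((N P)%:Z - (N P')%:Z) :
    wcp_diff W P W' P' true V R
| wcp_diff_borrow V R of
    (N W' < N W)%N & (N P < N P')%N &
    N V = (N W - N W' - 1)%N & is_rem R (len P) ((N P)%:Z - (N P')%:Z) :
    wcp_diff W P W' P' true V R
| wcp_diff_neg V R of
    N W = N W' & (N P < N P')%N &
    N V = 0%N & is_rem R (len P) ((N P')%:Z - (N P)%:Z) :
    wcp_diff W P W' P' false V R.

Inductive wcp_add : wcp -> wcp -> wcp -> Prop :=
| wcp_add_same s (W P W' P' V R : word) c of
    len P = len P' &
    (N V)%:Z = (N W)%:Z + (N W')%:Z
               + quo (len P) ((N P)%:Z + (N P')%:Z) &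
    is_rem R (len P) ((N P)%:Z + (N P')%:Z) :
    wcp_add (s, W, P, c) (s, W', P', c) (s, V, R, c)
| wcp_add_opp s (W P W' P' V R : word) c of
    len P = len P' & ~~ all_beta P & ~~ all_beta P' &
    wcp_diff W P W' P' s V R :
    wcp_add (true, W, P, c) (false, W', P', c) (s, V, R, c)
| wcp_add_opp_swap s (W P W' P' V R : word) c of
    len P = len P' & ~~ all_beta P & ~~ all_beta P' &
    (N W < N W')%N & wcp_diff W' P' W P s V R :
    wcp_add (true, W, P, c) (false, W', P', c) (~~ s, V, R, c)
| wcp_add_comm x y z of wcp_add x y z : wcp_add y x z.

Definition Db : {pred rat} :=
  [pred q : rat | `[< exists u e : int, q = u%:~R * (b%:R : rat) ^ e >]].

Definition db_elt := {d : rat | d \in Db}.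

Definition dc := (db_elt * word)%type.

Inductive dc_step : dc -> dc -> Prop :=
| dc_pow (d : db_elt) (P P' : word) k of (1 <= k)%N & is_power P' P k :
    dc_step (d, P) (d, P')
| dc_beta (d d' : db_elt) (P Z : word) of
    is_letter P b.-1 & is_letter Z 0 & val d' = val d + 1 :
    dc_step (d, P) (d', Z).

Definition Q_DC := gen_quot dc_step.

Inductive dc_add : dc -> dc -> dc -> Prop :=
| dc_add_intro (d d' d'' : db_elt) (P P' R : word) of
    len P = len P' &
    val d'' = val d + val d' + (quo (len P) ((N P)%:Z + (N P')%:Z))%:~R &
    is_rem R (len P) ((N P)%:Z + (N P')%:Z) :
    dc_add (d, P) (d', P') (d'', R).

End Words.

(* Main.v *)
(* Both sets embed in the rationals: a quadruple (s, W, P, c) writes the number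
   s (N(W) + N(P) / (b^l - 1)) b^c with l = |P|, and a pair (delta, P) the number
   delta + N(P) / (b^l - 1). Each identification preserves this number and the
   addition formulas add it. Conversely it determines the class: two elements
   have representatives with the same c, with circular words of the same length
   and different from beta^l, so that the periodic parts lie in [0, 1). For
   pairs, the difference of the two deltas lies in D_b and becomes an integer
   when multiplied by b^l - 1, so it is an integer. *)
Require Import Defs.
From mathcomp Require Import all_boot all_order all_algebra.
From mathcomp Require Import boolp.
From mathcomp Require Import zify ring lra.
From Stdlib Require Import Relations.Relation_Operators.

Set Implicit Arguments.
Unset Strict Implicit.
Unset Printing Implicit Defensive.

Import Order.TTheory GRing.Theory Num.Theory.
Local Open Scope ring_scope.

#[local] Arguments rst_step {A R x y}.
#[local] Arguments rst_sym {A R x y}.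
#[local] Arguments rst_trans {A R x y z}.

(** * Group structure pulled back along a valuation *)

Section Valuation.
Variables (T : choiceType) (step : T -> T -> Prop) (V : zmodType) (v : T -> V).
Variable rule : T -> T -> T -> Prop.
Hypothesis step_v : forall x y, step x y -> v x = v y.
Hypothesis v_step : forall x y, v x = v y -> clos_refl_sym_trans T step x y.
Hypothesis rule_v : forall x y z, rule x y z -> v z = v x + v y.
Hypothesis rule_ex : forall x y, exists x' y' z,
  [/\ v x' = v x, v y' = v y & rule x' y' z].
Hypothesis v_zero : exists x, v x = 0.
Hypothesis v_opp : forall x, exists y, v y = - v x.

Lemma class_of_eq x y : class_of step x = class_of step y <-> v x = v y.
Proof.
split=> [/eqmodP/asboolP|vxy]; last by apply/eqmodP/asboolP; exact: v_step.
by elim=> // x' y' z' _ -> _ ->.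
Qed.

Let vq (u : gen_quot step) : V := v (repr u).

Let class_ofK u : class_of step (repr u) = u.
Proof. exact: reprK. Qed.

Let vq_class x : vq (class_of step x) = v x.
Proof. by apply/class_of_eq; rewrite class_ofK. Qed.

Let vq_inj : injective vq.
Proof. by move=> x y /class_of_eq; rewrite !class_ofK. Qed.

(** The valuation descends to an injection of the quotient into [V]. By [rule_ex] and [rule_v] its
    image is closed under sums, and the last two hypotheses make it a subgroup, so every group law
    can be checked in [V]. *)
Lemma abelian_group_of_valuation :
  exists add : gen_quot step -> gen_quot step -> gen_quot step,
    induced_by rule add /\ abelian_group add.
Proof.
have sum_ex u w : exists t, vq t = vq u + vq w.
  have [x [y [z [vx vy /rule_v vz]]]] := rule_ex (repr u) (repr w).
  by exists (class_of step z); rewrite vq_class vz vx vy.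
have opp_ex u : exists t, vq t = - vq u.
  by have [y vy] := v_opp (repr u); exists (class_of step y); rewrite vq_class.
have [x0 vx0] := v_zero.
(* The operations are chosen by their values alone; injectivity of [vq] leaves only one choice. *)
pose add u w := projT1 (cid (sum_ex u w)).
pose opp u := projT1 (cid (opp_ex u)).
have vD u w : vq (add u w) = vq u + vq w by rewrite /add; case: cid.
have vN u : vq (opp u) = - vq u by rewrite /opp; case: cid.
exists add; split; last first.
  exists (class_of step x0), opp; split=> [x y z|x y|x|x]; apply: vq_inj.
  - by rewrite !vD addrA.
  - by rewrite !vD addrC.
  - by rewrite vD vq_class vx0 add0r.
  - by rewrite vD vN addNr vq_class.
split=> [x y z /rule_v vz|u w].
  by apply: vq_inj; rewrite vD !vq_class.
have [x [y [z [vx vy r]]]] := rule_ex (repr u) (repr w).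
by exists x, y, z; split=> //; apply: vq_inj; rewrite vq_class.
Qed.

End Valuation.

(** * Words as base-b numerals *)

Section Words.
Variables (b : nat) (hb : (2 <= b)%N).

Local Notation word := (word b).
Local Notation B := (b%:R : rat).

(** A recursive form of [N], extended to the empty sequence, which allows induction on the
    letters. *)
Fixpoint num (s : seq 'I_b) : nat :=
  if s is x :: s' then (x * b ^ size s' + num s')%N else 0%N.

Lemma NE (W : word) : N W = num (val W).
Proof.
rewrite /N; elim: (val W) => [|x s IH] /=.
  by rewrite big_ord0.
rewrite big_ord_recl (tnth_nth x) /= subn1 subn0 -IH; congr addn.
apply: eq_bigr => i _; rewrite !(tnth_nth x) /= /bump /=.
by congr (_ * b ^ _)%N; lia.
Qed.

Lemma num_cat s t : num (s ++ t) = (num s * b ^ size t + num t)%N.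
Proof. by elim: s => //= x s ->; rewrite size_cat expnD; ring. Qed.

Lemma num_lt s : (num s < b ^ size s)%N.
Proof.
elim: s => //= x s IH; rewrite expnS.
have : (x.+1 * b ^ size s <= b * b ^ size s)%N by rewrite leq_mul2r ltn_ord orbT.
by rewrite mulSn; lia.
Qed.

(** The tail is smaller than b^|t|, so dividing by b^|t| recovers the leading letter. *)
Lemma num_inj s t : size s = size t -> num s = num t -> s = t.
Proof.
elim: s t => [|x s IH] [|y t] //= [est] e.
have [ls lt] := (num_lt s, num_lt t); rewrite est in ls e.
have exy : x = y.
  apply/val_inj; have := congr1 (divn^~ (b ^ size t)%N) e.
  by rewrite !divnMDl ?expn_gt0; [rewrite !divn_small ?addn0| lia|lia].
by rewrite exy (IH t) //; move: e; rewrite exy => /addnI.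
Qed.

Lemma num_ex l n : (n < b ^ l)%N -> exists2 s, size s = l & num s = n.
Proof.
elim: l n => [|l IH] n; first by case: n => //; exists [::].
rewrite expnS => ln; have bl : (0 < b ^ l)%N by rewrite expn_gt0; lia.
have [s es en] := IH _ (ltn_pmod n bl).
have xb : (n %/ b ^ l < b)%N by rewrite ltn_divLR.
by exists (Ordinal xb :: s); rewrite /= ?es // en -divn_eq.
Qed.

Lemma word_ex l n : (0 < l)%N -> (n < b ^ l)%N ->
  exists2 W : word, len W = l & N W = n.
Proof.
move=> l0 /num_ex [s es en].
have s0 : s != [::] by rewrite -size_eq0 es; lia.
by exists (exist _ s s0); rewrite ?NE.
Qed.

Lemma N_ex n : exists W : word, N W = n.
Proof.
have [|W _ <-] := @word_ex n.+1 n isT; last by exists W.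
by apply: leq_trans (ltn_expl n hb) _; rewrite leq_exp2l.
Qed.

Lemma letter_ex n : (n < b)%N -> exists W : word, is_letter W n.
Proof. by move=> nb; exists (exist _ [:: Ordinal nb] isT); exists (Ordinal nb). Qed.

Lemma letter_N (W : word) n : is_letter W n -> N W = n /\ len W = 1.
Proof. by case=> x ex <-; rewrite NE /len ex /= expn0 muln1 addn0. Qed.

Lemma len_gt0 (P : word) : (0 < len P)%N.
Proof. by case: P => [[]]. Qed.

Lemma N_lt (P : word) : (N P < b ^ len P)%N.
Proof. by rewrite NE num_lt. Qed.

Lemma word_inj (P P' : word) : len P = len P' -> N P = N P' -> P = P'.
Proof. by rewrite !NE => eP /(num_inj eP) /val_inj. Qed.

Lemma power_ex (P : word) k : (1 <= k)%N -> exists P' : word, is_power P' P k.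
Proof.
move=> k1; have s0 : flatten (nseq k (val P)) != [::].
  by case: k k1 => //= k _; case: P => [[]].
by exists (exist _ (flatten (nseq k (val P))) s0).
Qed.

Lemma len_power (P P' : word) k : is_power P' P k -> len P' = (k * len P)%N.
Proof. by rewrite /len => ->; elim: k => //= k IH; rewrite size_cat IH mulSn. Qed.

(** * Values of purely periodic expansions *)

Definition modulus l : rat := B ^+ l - 1.

(* The value of the purely periodic expansion 0.PPP... in base b. *)
Definition frac (P : word) : rat := (N P)%:R / modulus (len P).

Lemma modulus_gt0 l : (0 < l)%N -> 0 < modulus l.
Proof. by move=> l0; rewrite subr_gt0 exprn_egt1 -?lt0n ?ltr1n //. Qed.

Lemma modulus_len_neq0 (P : word) : modulus (len P) != 0.
Proof. by rewrite gt_eqF ?modulus_gt0 ?len_gt0. Qed.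

Lemma fracM (P : word) : frac P * modulus (len P) = (N P)%:R.
Proof. by rewrite mulfVK ?modulus_len_neq0. Qed.

Lemma frac_num (P : word) x : x * modulus (len P) = (N P)%:R -> frac P = x.
Proof. by rewrite -fracM => /(mulIf (modulus_len_neq0 P)). Qed.

(** In the induction, x b^|s| + num s reaches b^(|s|+1) - 1 only if both the leading letter and the
    tail are maximal. *)
Lemma all_betaE (P : word) : all_beta P = (N P == b ^ len P - 1)%N.
Proof.
rewrite NE /all_beta /len; elim: (val P) => //= x s ->.
have := num_lt s; rewrite expnS.
have := ltn_ord x; set m := (b ^ size s)%N => xb sm.
apply/andP/eqP => [[/eqP -> /eqP ->]|e]; first nia.
have : x = b.-1 :> nat by nia.
by move=> ex; rewrite ex eqxx; split=> //; apply/eqP; nia.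
Qed.

Lemma frac_ge0 P : 0 <= frac P.
Proof. by rewrite divr_ge0 ?ler0n // ltW // modulus_gt0 // len_gt0. Qed.

Lemma frac_lt1 P : ~~ all_beta P -> frac P < 1.
Proof.
rewrite all_betaE => Pb; rewrite ltr_pdivrMr ?modulus_gt0 ?len_gt0 //.
rewrite mul1r ltrBrDr -natrX natr1 ltr_nat; have := N_lt P; lia.
Qed.

Lemma frac_beta P : all_beta P -> frac P = 1.
Proof.
rewrite all_betaE => /eqP eP; apply: frac_num; rewrite mul1r eP natrB ?natrX //.
by rewrite expn_gt0; lia.
Qed.

(** With the denominator cleared, the claim also makes sense for k = 0, where it reads 0 = 0; this
    is the base of the induction on [k]. *)
Lemma frac_power (P P' : word) k : is_power P' P k -> frac P' = frac P.
Proof.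
move=> pw; apply: frac_num; rewrite (len_power pw) NE pw {pw}.
elim: k => [|k IH] /=; first by rewrite /modulus expr0 subrr mulr0.
rewrite num_cat natrD natrM -IH -NE -fracM natrX /modulus.
have szP : size (flatten (nseq k (val P))) = (k * len P)%N.
  by elim: k {IH} => //= k IH; rewrite size_cat IH mulSn.
by rewrite szP mulSn exprD; ring.
Qed.

(** Multiplying 0.PPP... by b moves the letter [p0] in front of the point and leaves the expansion
    of the shifted word behind it. *)
Lemma frac_shift (P P' : word) (p0 : 'I_b) p : val P = p0 :: p ->
  val P' = rot 1 (val P) -> frac P' = B * frac P - p0%:R.
Proof.
move=> eP eP'; apply: frac_num.
have -> : len P' = len P by rewrite /len eP' size_rot.
rewrite mulrBl -mulrA fracM !NE eP' eP rot1_cons -cats1 num_cat /len eP /=.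
rewrite expn0 expn1 muln1 addn0 !natrD !natrM natrX /modulus exprS.
by ring.
Qed.

Lemma frac_inj (P P' : word) : len P = len P' -> frac P = frac P' -> P = P'.
Proof.
move=> l eP; apply: (word_inj l); apply/eqP; rewrite -(eqr_nat rat).
by rewrite -!fracM l eP.
Qed.

Lemma nat_frac_inj (m n : nat) x y : 0 <= x < 1 -> 0 <= y < 1 ->
  m%:R + x = n%:R + y :> rat -> m = n /\ x = y.
Proof.
move=> /andP[x0 x1] /andP[y0 y1] e.
have mn : m = n.
  have : (m < n.+1)%N by rewrite -(ltr_nat rat) -addn1 natrD; lra.
  have : (n < m.+1)%N by rewrite -(ltr_nat rat) -addn1 natrD; lra.
  lia.
by split=> //; move: e; rewrite mn => /addrI.
Qed.

(** * Quotients and remainders modulo b^l - 1 *)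

Lemma intr_modulus l : ((b ^ l)%:Z - 1)%:~R = modulus l.
Proof. by rewrite rmorphB /= -pmulrn natrX. Qed.

Lemma rem_ex l M : (0 < l)%N -> exists R : word, is_rem R l M.
Proof.
move=> l0; have D0 : (0 < (b ^ l)%:Z - 1)%R.
  by rewrite -(ltr_int rat) intr_modulus modulus_gt0.
have r0 := modz_ge0 M (lt0r_neq0 D0); have rD := ltz_pmod M D0.
have [|R lR NR] := @word_ex l `|(M %% ((b ^ l)%:Z - 1))%Z|%N l0; first by lia.
by exists R; split=> //; rewrite NR; lia.
Qed.

Lemma frac_rem (R : word) l M : is_rem R l M ->
  frac R = M%:~R / modulus l - (quo b l M)%:~R.
Proof.
move=> [lR NR]; have l0 : (0 < l)%N by rewrite -lR len_gt0.
apply: frac_num; rewrite lR mulrBl mulfVK ?gt_eqF ?modulus_gt0 //.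
by rewrite pmulrn NR -intr_modulus -rmorphM -rmorphB.
Qed.

Lemma frac_rem_add (P P' R : word) : len P = len P' ->
  is_rem R (len P) ((N P)%:Z + (N P')%:Z) ->
  frac P + frac P' = (quo b (len P) ((N P)%:Z + (N P')%:Z))%:~R + frac R.
Proof.
move=> eP /frac_rem ->; rewrite [RHS]addrC subrK rmorphD /= mulrDl.
by rewrite {2}/frac -eP.
Qed.

(** Since neither word is beta^l, both integers are below b^l - 1. Their difference thus has
    quotient 0 or -1, and -1 occurs exactly when a unit must be borrowed. *)
Lemma frac_rem_sub (P P' R : word) : len P = len P' ->
  ~~ all_beta P -> ~~ all_beta P' ->
  is_rem R (len P) ((N P)%:Z - (N P')%:Z) ->
  frac R = frac P - frac P' + (N P < N P')%:R.
Proof.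
move=> eP; rewrite !all_betaE -eP => bP bP' [lR NR].
have ltP := N_lt P; have ltP' := N_lt P'; rewrite -eP in ltP'.
apply: frac_num; rewrite mulrDl mulrBl lR fracM {1}eP fracM.
rewrite [(N R)%:R]pmulrn NR -intr_modulus.
rewrite [(N P)%:R]pmulrn [(N P')%:R]pmulrn.
rewrite [(_ < _)%N%:R]pmulrn -!rmorphM -rmorphB -rmorphD; congr (_%:~R).
case: ltnP => ltN; last by rewrite modz_small; lia.
by rewrite -modzDr modz_small; lia.
Qed.

Lemma all_beta_frac P : all_beta P = (frac P == 1).
Proof.
by apply/idP/eqP => [/frac_beta //|]; apply: contra_eqT => /frac_lt1/lt_eqF->.
Qed.

Lemma frac_letter0 (Z : word) : is_letter Z 0 -> frac Z = 0.
Proof. by move=> /letter_N[NZ _]; rewrite /frac NZ mul0r. Qed.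

Lemma frac_letter_beta (P : word) : is_letter P b.-1 -> frac P = 1.
Proof.
by move=> /letter_N[NP lP]; apply: frac_beta; rewrite all_betaE NP lP subn1.
Qed.

Lemma frac_bounds P : ~~ all_beta P -> 0 <= frac P < 1.
Proof. by move=> /frac_lt1 ->; rewrite frac_ge0. Qed.

Lemma B_neq0 : B != 0.
Proof. by rewrite pnatr_eq0; lia. Qed.

Local Notation wcp_equiv := (clos_refl_sym_trans _ (@wcp_step b)).
Local Notation dc_equiv := (clos_refl_sym_trans _ (@dc_step b)).

(** * The value of a quadruple *)

Definition wcp_val (x : wcp b) : rat :=
  let: (s, W, P, c) := x in (-1) ^+ (~~ s) * ((N W)%:R + frac P) * B ^ c.

Lemma wcp_step_val x y : wcp_step x y -> wcp_val x = wcp_val y.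
Proof.
case=> [s W W' P c z z0 eW|s W P P' c k _ pw|s W V P Z c Pb Z0 NV|
        s W W' P P' c p0 p eP eW eP'|Z c Z0] /=.
- by rewrite !NE eW /= z0 mul0n.
- by rewrite (frac_power pw).
- by rewrite (frac_letter_beta Pb) (frac_letter0 Z0) NV natrD addr0.
(* The prefix becomes b N(W) + p0 and the periodic part b frac P - p0; their sum is multiplied by b,
   which the exponent [c - 1] compensates. *)
- rewrite (frac_shift eP eP') !NE eW -cats1 num_cat /= expn0 expn1 muln1 addn0.
  rewrite natrD natrM expfzDr ?B_neq0 // exprN1.
  by field; exact: B_neq0.
- by rewrite (frac_letter0 Z0) (letter_N Z0).1 addr0 !mulr0.
Qed.

Lemma wcp_equiv_val x y : wcp_equiv x y -> wcp_val x = wcp_val y.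
Proof. by elim=> [|||x' y' z' _ -> _ ->] //; exact: wcp_step_val. Qed.

(** * Representatives of quadruples and equality of classes *)

Lemma wcp_pad s (W P : word) c k : exists W' : word,
  [/\ len W' = (k + len W)%N, N W' = N W & wcp_equiv (s, W, P, c) (s, W', P, c)].
Proof.
elim: k => [|k [W' [lW NW eW]]]; first by exists W; split=> //; exact: rst_refl.
have b0 : (0 < b)%N by lia.
exists (exist _ (Ordinal b0 :: val W') isT); split.
- by rewrite /len /= -/(len W') lW.
- by rewrite -NW !NE.
- apply: rst_trans eW _; apply: rst_step.
  exact: (@wcp_lead _ _ _ _ _ _ (Ordinal b0)).
Qed.

(** Each prefix is padded with as many zeros as the other has letters. The padded words have the
    same length and write the same integer, so they coincide. *)
Lemma wcp_eq_prefix s (W W' P : word) c : N W = N W' ->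
  wcp_equiv (s, W, P, c) (s, W', P, c).
Proof.
move=> eN.
have [V [lV NV eV]] := wcp_pad s W P c (len W').
have [V' [lV' NV' eV']] := wcp_pad s W' P c (len W).
have eVV : V = V' by apply: word_inj; rewrite ?lV ?lV' 1?addnC // NV NV'.
by apply: rst_trans eV _; rewrite eVV; apply: rst_sym.
Qed.

Lemma wcp_shiftn s (W P : word) c n : exists W' P' : word,
  len P' = len P /\ wcp_equiv (s, W, P, c) (s, W', P', c - n%:Z).
Proof.
elim: n => [|n [W' [P' [lP eW]]]].
  by exists W, P; rewrite subr0; split=> //; exact: rst_refl.
case eP: (val P') => [|p0 p]; first by have := valP P'; rewrite eP.
have W0 : rcons (val W') p0 != [::] by rewrite -size_eq0 size_rcons.
have P0 : rot 1 (val P') != [::] by rewrite -size_eq0 size_rot size_eq0 (valP P').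
exists (exist _ (rcons (val W') p0) W0), (exist _ (rot 1 (val P')) P0); split.
  by rewrite -lP /len /= size_rot.
apply: rst_trans eW _; rewrite intS opprD [- 1 - _]addrC addrA.
by apply: rst_step; exact: (@wcp_shift _ _ _ _ _ _ _ p0 p).
Qed.

(** The rules for beta and 0 concern one-letter circular words; this recognises beta^l and 0^l as
    powers of them. The power of [L] as long as [P] has the same value, hence equals [P]. *)
Lemma word_power (P L : word) : len L = 1 -> frac P = frac L ->
  is_power P L (len P).
Proof.
move=> lL eP; have [P' pw] := power_ex L (len_gt0 P).
suff PP' : P = P' by rewrite {1}PP'.
by apply: frac_inj; rewrite ?(len_power pw) ?lL ?muln1 // (frac_power pw).
Qed.

(** The word beta^l is contracted to beta, traded for 0 with a carry into the prefix, then expanded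
    to 0^l, so that the length is kept. *)
Lemma wcp_nobeta s (W P : word) c : exists V P' : word,
  [/\ len P' = len P, ~~ all_beta P' & wcp_equiv (s, W, P, c) (s, V, P', c)].
Proof.
have [bP|nbP] := boolP (all_beta P); last first.
  by exists W, P; split=> //; exact: rst_refl.
have [L Lb] : exists L : word, is_letter L b.-1 by apply: letter_ex; lia.
have [Z Z0] : exists Z : word, is_letter Z 0 by apply: letter_ex; lia.
have [V NV] := N_ex (N W + 1).
have [P' pw] := power_ex Z (len_gt0 P).
exists V, P'; split.
- by rewrite (len_power pw) (letter_N Z0).2 muln1.
- by rewrite all_beta_frac (frac_power pw) frac_letter0.
apply: (rst_trans _ (rst_step (wcp_pow s V c (len_gt0 P) pw))).
apply: (rst_trans _ (rst_step (wcp_beta s c Lb Z0 NV))).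
apply: rst_sym; apply: rst_step; apply: (wcp_pow s W c (len_gt0 P)).
by apply: word_power; rewrite ?(letter_N Lb).2 ?(frac_letter_beta Lb) ?frac_beta.
Qed.

Lemma wcp_normal s (W P : word) c n k : (0 < k)%N -> exists W' P' : word,
  [/\ len P' = (len P * k)%N, ~~ all_beta P'
    & wcp_equiv (s, W, P, c) (s, W', P', c - n%:Z)].
Proof.
move=> k0; have [W1 [P1 [l1 e1]]] := wcp_shiftn s W P c n.
have [P2 pw] := power_ex P1 k0.
have [W3 [P3 [l3 nb3 e3]]] := wcp_nobeta s W1 P2 (c - n%:Z).
exists W3, P3; split=> //; first by rewrite l3 (len_power pw) l1 mulnC.
apply: rst_trans e1 _; apply: (rst_trans _ e3); apply: rst_step.
exact: wcp_pow pw.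
Qed.

Lemma wcp_common (x y : wcp b) : exists s s' (W W' P P' : word) c,
  [/\ len P = len P', ~~ all_beta P /\ ~~ all_beta P',
      wcp_equiv x (s, W, P, c) & wcp_equiv y (s', W', P', c)].
Proof.
case: x y => [[[s W] P] c] [[[s' W'] P'] c'].
(* Shifts lower both exponents to their minimum, and each circular word is repeated as many times as
   the other has letters. *)
have [W1 [P1 [l1 nb1 e1]]] :=
  wcp_normal s W P c `|c - Num.min c c'| (len_gt0 P').
have [W2 [P2 [l2 nb2 e2]]] :=
  wcp_normal s' W' P' c' `|c' - Num.min c c'| (len_gt0 P).
exists s, s', W1, W2, P1, P2, (Num.min c c'); split.
- by rewrite l1 l2 mulnC.
- by [].
- by have <- : c - `|c - Num.min c c'|%N%:Z = Num.min c c' by lia.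
- by have <- : c' - `|c' - Num.min c c'|%N%:Z = Num.min c c' by lia.
Qed.

(** Both summands are nonnegative, so both vanish: [W] writes 0 and [P] is a power of the letter 0.
    With either sign the quadruple reduces to the one-letter form to which the sign rule applies. *)
Lemma wcp_zero s (W P : word) c : (N W)%:R + frac P = 0 ->
  wcp_equiv (s, W, P, c) (~~ s, W, P, c).
Proof.
move=> e0; have := frac_ge0 P; have : 0 <= (N W)%:R :> rat by [].
move=> W0 P0; have fP : frac P = 0 by lra.
have NW : N W = 0%N by apply/eqP; rewrite -(eqr_nat rat); apply/eqP; lra.
have [Z Z0] : exists Z : word, is_letter Z 0 by apply: letter_ex; lia.
have pw : is_power P Z (len P).
  by apply: word_power; rewrite ?(letter_N Z0).2 // fP frac_letter0.
have to_letter t : wcp_equiv (t, W, P, c) (t, Z, Z, c).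
  apply: rst_trans (wcp_eq_prefix _ _ _ (W' := Z) _) _.
    by rewrite NW (letter_N Z0).1.
  by apply: rst_sym; apply: rst_step; exact: wcp_pow (len_gt0 P) pw.
apply: rst_trans (to_letter s) _.
apply: (rst_trans _ (rst_sym (to_letter (~~ s)))).
by case: s => /=; [|apply: rst_sym]; apply: rst_step; exact: wcp_sign.
Qed.

Lemma wcp_val_equiv x y : wcp_val x = wcp_val y -> wcp_equiv x y.
Proof.
have [s [s' [W [W' [P [P' [c [lP [nb nb'] ex ey]]]]]]]] := wcp_common x y.
rewrite (wcp_equiv_val ex) (wcp_equiv_val ey) => e.
apply: rst_trans ex _; apply: (rst_trans _ (rst_sym ey)) => {x y ey}.
have {e} := mulIf (expfz_neq0 c B_neq0) e.
(* Both periodic parts lie in [0, 1), so equal absolute values have equal integer and fractional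
   parts. *)
have same t : (N W)%:R + frac P = (N W')%:R + frac P' ->
    wcp_equiv (t, W, P, c) (t, W', P', c).
  move=> /(nat_frac_inj (frac_bounds nb) (frac_bounds nb'))[NW /(frac_inj lP) ->].
  exact: wcp_eq_prefix.
have [W0 W0'] : 0 <= (N W)%:R :> rat /\ 0 <= (N W')%:R :> rat by [].
have [P0 P0'] := (frac_ge0 P, frac_ge0 P').
have [-> /mulfI e|ss' e] := eqVneq s s'; first by apply/same/e; case: (s').
have es : s' = ~~ s by case: (s) (s') ss' => [] [].
move: e; rewrite es => e.
(* Two nonnegative numbers that agree up to opposite signs are both zero. *)
have e0 : (N W)%:R + frac P = (N W')%:R + frac P' /\ (N W)%:R + frac P = 0.
  by move: e; case: (s) => /=; rewrite ?expr0 ?expr1; lra.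
by apply: rst_trans (wcp_zero _ _ e0.2) (same _ e0.1).
Qed.

(** * Addition of quadruples *)

Lemma wcp_diff_val (W P W' P' V R : word) s : len P = len P' ->
  ~~ all_beta P -> ~~ all_beta P' -> wcp_diff W P W' P' s V R ->
  (-1) ^+ (~~ s) * ((N V)%:R + frac R)
    = ((N W)%:R + frac P) - ((N W')%:R + frac P').
Proof.
move=> lP nb nb' [{}V {}R leW leP NV|{}V {}R ltW ltP NV|{}V {}R eW ltP NV].
(* The borrowed unit given by [frac_rem_sub] is 0 in the first case and is offset by the -1 in [N V]
   in the second. In the third the operands are exchanged, so it is 0 again. *)
- move=> /(frac_rem_sub lP nb nb') ->; rewrite NV natrB //.
  by rewrite ltnNge leP /=; ring.
- move=> /(frac_rem_sub lP nb nb') ->; rewrite NV ltP -subnDA natrB; last lia.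
  by rewrite natrD /=; ring.
- rewrite lP => /(frac_rem_sub (esym lP) nb' nb) ->.
  by rewrite NV eW ltnNge (ltnW ltP) /=; ring.
Qed.

Lemma wcp_diff_ex (W P W' P' : word) : (N W' <= N W)%N ->
  exists s V R, wcp_diff W P W' P' s V R.
Proof.
move=> leW; have l0 := len_gt0 P.
have [leP|ltP] := leqP (N P') (N P).
  have [V NV] := N_ex (N W - N W').
  have [R rR] := rem_ex ((N P)%:Z - (N P')%:Z) l0.
  by exists true, V, R; exact: wcp_diff_ge.
move: leW; rewrite leq_eqVlt => /orP[/eqP eW|ltW].
  have [V NV] := N_ex 0.
  have [R rR] := rem_ex ((N P')%:Z - (N P)%:Z) l0.
  by exists false, V, R; exact: wcp_diff_neg.
have [V NV] := N_ex (N W - N W' - 1).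
have [R rR] := rem_ex ((N P)%:Z - (N P')%:Z) l0.
by exists true, V, R; exact: wcp_diff_borrow.
Qed.

Lemma wcp_add_val x y z : wcp_add x y z -> wcp_val z = wcp_val x + wcp_val y.
Proof.
elim=> {x y z} [s W P W' P' V R c lP NV rR|s W P W' P' V R c lP nb nb' d|
  s W P W' P' V R c lP nb nb' _ d|x y z _ ->]; last exact: addrC.
- rewrite /= -mulrDl -mulrDr; congr (_ * _ * _).
  have := frac_rem_add lP rR.
  have : (N V)%:R = (N W)%:R + (N W')%:R
    + (quo b (len P) ((N P)%:Z + (N P')%:Z))%:~R :> rat.
    by rewrite [LHS]pmulrn NV !rmorphD.
  by lra.
- by rewrite /= (wcp_diff_val lP nb nb' d); ring.
- have e : (-1) ^+ (~~ ~~ s) = - (-1) ^+ (~~ s) :> rat by case: (s).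
  rewrite /= e mulNr (wcp_diff_val (esym lP) nb' nb d); ring.
Qed.

Lemma wcp_add_ex x y : exists x' y' z,
  [/\ wcp_val x' = wcp_val x, wcp_val y' = wcp_val y & wcp_add x' y' z].
Proof.
have [s [s' [W [W' [P [P' [c [lP [nb nb'] ex ey]]]]]]]] := wcp_common x y.
suff [z zP] : exists z, wcp_add (s, W, P, c) (s', W', P', c) z.
  exists (s, W, P, c), (s', W', P', c), z; split=> //.
  - exact/esym/wcp_equiv_val.
  - exact/esym/wcp_equiv_val.
(* The formulas for opposite signs put the positive operand first; the other order is left to
   [wcp_add_comm]. *)
have opp (W1 P1 W2 P2 : word) : len P1 = len P2 -> ~~ all_beta P1 -> ~~ all_beta P2 ->
    exists z, wcp_add (true, W1, P1, c) (false, W2, P2, c) z.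
  move=> l12 nb1 nb2; have [le|lt] := leqP (N W2) (N W1).
    have [t [V [R d]]] := wcp_diff_ex P1 P2 le.
    by exists (t, V, R, c); exact: wcp_add_opp.
  have [t [V [R d]]] := wcp_diff_ex P2 P1 (ltnW lt).
  by exists (~~ t, V, R, c); exact: wcp_add_opp_swap.
have [<-|] := eqVneq s s'; last first.
  case: (s) (s') => [] [] // _; first exact: opp.
  have [z zP] := opp W' P' W P (esym lP) nb' nb.
  by exists z; exact: wcp_add_comm.
have [R rR] := rem_ex ((N P)%:Z + (N P')%:Z) (len_gt0 P).
(* The prefix of the sum has to write a natural number, so the carry must be nonnegative. *)
have q0 : 0 <= quo b (len P) ((N P)%:Z + (N P')%:Z).
  rewrite divz_ge0 //; last by rewrite -(ltr_int rat) intr_modulus modulus_gt0 ?len_gt0.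
have [V NV] := N_ex (N W + N W' + `|quo b (len P) ((N P)%:Z + (N P')%:Z)|).
exists (s, V, R, c); apply: wcp_add_same => //.
by rewrite NV; lia.
Qed.

Lemma wcp_group : exists add : Q_WCP b -> Q_WCP b -> Q_WCP b,
  induced_by (@wcp_add b) add /\ abelian_group add.
Proof.
apply: (@abelian_group_of_valuation _ _ _ wcp_val).
- exact: wcp_step_val.
- exact: wcp_val_equiv.
- exact: wcp_add_val.
- exact: wcp_add_ex.
- have [Z Z0] : exists Z : word, is_letter Z 0 by apply: letter_ex; lia.
  exists (true, Z, Z, 0).
  by rewrite /= (frac_letter0 Z0) (letter_N Z0).1 addr0 mulr0 mul0r.
- by case=> [[[s W] P] c]; exists (~~ s, W, P, c); case: s; rewrite /=; ring.
Qed.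

(** * Rationals whose denominator divides a power of b *)

Lemma DbP (q : rat) : reflect (exists n : nat, q * B ^+ n \is a Num.int) (q \in Db b).
Proof.
apply: (iffP (asboolP _)) => [[u [e ->]]|[n /intrP[u e]]].
  case: e => n; first by exists 0%N; rewrite mulr1 -exprnP rpredM ?rpredX ?intr_int ?natr_int.
  by exists n.+1; rewrite NegzE -exprnN mulfVK ?expf_neq0 ?B_neq0 ?intr_int.
by exists u, (- n%:Z); rewrite -exprnN -e mulfK ?expf_neq0 ?B_neq0.
Qed.

Lemma Db_int q : q \is a Num.int -> q \in Db b.
Proof. by move=> qi; apply/DbP; exists 0%N; rewrite mulr1. Qed.

Lemma Db_add p q : p \in Db b -> q \in Db b -> p + q \in Db b.
Proof.
move=> /DbP[m hm] /DbP[n hn]; apply/DbP; exists (m + n)%N.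
have -> : (p + q) * B ^+ (m + n) = p * B ^+ m * B ^+ n + q * B ^+ n * B ^+ m.
  by rewrite exprD; ring.
by apply: rpredD; apply: rpredM => //; rewrite rpredX ?natr_int.
Qed.

Lemma Db_opp p : p \in Db b -> - p \in Db b.
Proof. by move=> /DbP[m hm]; apply/DbP; exists m; rewrite mulNr rpredN. Qed.

(* The denominator of an element of D_b divides a power of b, which is coprime
   to b^l - 1. *)
Lemma Db_modulus_int q l : (0 < l)%N -> q \in Db b ->
  q * modulus l \is a Num.int -> q \is a Num.int.
Proof.
move=> l0 /DbP[n /intrP[u eu]] /intrP[m em].
have cop : coprimez (b%:Z ^+ n) (b%:Z ^+ l - 1).
  (* The Bezout relation is b^(l-1) b - (b^l - 1) = 1; coprimality then passes from b to b^n. *)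
  apply/coprimezXl/coprimezP; exists (b%:Z ^+ l.-1, -1) => /=.
  by rewrite -exprSr prednK //; ring.
(* Both sides equal q b^n (b^l - 1). *)
have eum : u * (b%:Z ^+ l - 1) = m * b%:Z ^+ n.
  apply: (@intr_inj rat); rewrite !rmorphM rmorphB !rmorphXn /= -!pmulrn.
  by rewrite -eu -em /modulus mulrAC.
have /dvdzP[t et] : (b%:Z ^+ n %| u)%Z.
  by rewrite -(Gauss_dvdzl _ cop) eum dvdz_mull.
apply/intrP; exists t; apply: (mulIf (expf_neq0 n B_neq0)).
by rewrite eu et rmorphM rmorphXn /= -pmulrn.
Qed.

(** * The value, representatives and addition of pairs *)

Definition dc_val (x : dc b) : rat := val x.1 + frac x.2.

Lemma dc_step_val x y : dc_step x y -> dc_val x = dc_val y.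
Proof.
case=> [d P P' k _ pw|d d' P Z Pb Z0 dd']; rewrite /dc_val /=.
  by rewrite (frac_power pw).
by rewrite (frac_letter_beta Pb) (frac_letter0 Z0) dd' addr0.
Qed.

Lemma dc_equiv_val x y : dc_equiv x y -> dc_val x = dc_val y.
Proof. by elim=> [|||x' y' z' _ -> _ ->] //; exact: dc_step_val. Qed.

Lemma dc_nobeta (d : db_elt b) (P : word) : exists d' (P' : word),
  [/\ len P' = len P, ~~ all_beta P' & dc_equiv (d, P) (d', P')].
Proof.
have [bP|nbP] := boolP (all_beta P); last first.
  by exists d, P; split=> //; exact: rst_refl.
have [L Lb] : exists L : word, is_letter L b.-1 by apply: letter_ex; lia.
have [Z Z0] : exists Z : word, is_letter Z 0 by apply: letter_ex; lia.
have d1 : val d + 1 \in Db b by rewrite Db_add ?(valP d) ?Db_int.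
have [P' pw] := power_ex Z (len_gt0 P).
exists (exist (fun q => q \in Db b) _ d1), P'; split.
- by rewrite (len_power pw) (letter_N Z0).2 muln1.
- by rewrite all_beta_frac (frac_power pw) frac_letter0.
apply: (rst_trans _ (rst_step (dc_pow _ (len_gt0 P) pw))).
apply: (rst_trans _ (rst_step (@dc_beta _ d _ _ _ Lb Z0 _))) => //.
apply: rst_sym; apply: rst_step; apply: (dc_pow d (len_gt0 P)).
by apply: word_power; rewrite ?(letter_N Lb).2 ?(frac_letter_beta Lb) ?frac_beta.
Qed.

Lemma dc_normal (d : db_elt b) (P : word) k : (0 < k)%N ->
  exists d' (P' : word),
  [/\ len P' = (len P * k)%N, ~~ all_beta P' & dc_equiv (d, P) (d', P')].
Proof.
move=> k0; have [P2 pw] := power_ex P k0.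
have [d' [P3 [l3 nb3 e3]]] := dc_nobeta d P2.
exists d', P3; split=> //; first by rewrite l3 (len_power pw) mulnC.
by apply: (rst_trans _ e3); apply: rst_step; exact: dc_pow pw.
Qed.

Lemma dc_common (x y : dc b) : exists (d d' : db_elt b) (P P' : word),
  [/\ len P = len P', ~~ all_beta P /\ ~~ all_beta P',
      dc_equiv x (d, P) & dc_equiv y (d', P')].
Proof.
case: x y => [d P] [d' P'].
have [d1 [P1 [l1 nb1 e1]]] := dc_normal d P (len_gt0 P').
have [d2 [P2 [l2 nb2 e2]]] := dc_normal d' P' (len_gt0 P).
by exists d1, d2, P1, P2; split=> //; rewrite l1 l2 mulnC.
Qed.

Lemma dc_val_equiv x y : dc_val x = dc_val y -> dc_equiv x y.
Proof.
have [d [d' [P [P' [lP [nb nb'] ex ey]]]]] := dc_common x y.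
rewrite (dc_equiv_val ex) (dc_equiv_val ey).
move=> e; have {}e : val d + frac P = val d' + frac P' := e.
apply: rst_trans ex _; apply: (rst_trans _ (rst_sym ey)) => {x y ey}.
have dE : val d - val d' = frac P' - frac P by lra.
have /intrP[m em] : val d - val d' \is a Num.int.
  apply: (Db_modulus_int (len_gt0 P)); first exact: Db_add (valP d) (Db_opp (valP d')).
  by rewrite dE mulrBl {1}lP !fracM rpredB ?natr_int.
(* An integer that is a difference of two numbers in [0, 1) is 0. *)
have m0 : m = 0.
  have /andP[f0 f1] := frac_bounds nb; have /andP[f0' f1'] := frac_bounds nb'.
  have : m < 1 by rewrite -(ltr_int rat) -em dE; lra.
  have : - 1 < m by rewrite -(ltr_int rat) -em dE; lra.
  by lia.
have dd : d = d' by apply: val_inj; apply/eqP; rewrite -subr_eq0 em m0.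
have -> : P = P' by apply: frac_inj => //; rewrite dd in e; move/addrI: e.
by rewrite dd; exact: rst_refl.
Qed.

Lemma dc_add_val x y z : dc_add x y z -> dc_val z = dc_val x + dc_val y.
Proof.
case=> d d' d'' P P' R lP dE rR.
suff: val d'' + frac R = val d + frac P + (val d' + frac P') by [].
by rewrite dE; have := frac_rem_add lP rR; lra.
Qed.

Lemma dc_add_ex x y : exists x' y' z,
  [/\ dc_val x' = dc_val x, dc_val y' = dc_val y & dc_add x' y' z].
Proof.
have [d [d' [P [P' [lP _ ex ey]]]]] := dc_common x y.
have [R rR] := rem_ex ((N P)%:Z + (N P')%:Z) (len_gt0 P).
have dd : val d + val d' + (quo b (len P) ((N P)%:Z + (N P')%:Z))%:~R \in Db b.
  by apply: Db_add; [exact: Db_add (valP d) (valP d')|exact/Db_int/intr_int].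
exists (d, P), (d', P'), (exist (fun q => q \in Db b) _ dd, R); split.
- exact/esym/dc_equiv_val.
- exact/esym/dc_equiv_val.
- exact: dc_add_intro.
Qed.

Lemma dc_group : exists add : Q_DC b -> Q_DC b -> Q_DC b,
  induced_by (@dc_add b) add /\ abelian_group add.
Proof.
have [Z Z0] : exists Z : word, is_letter Z 0 by apply: letter_ex; lia.
apply: (@abelian_group_of_valuation _ _ _ dc_val).
- exact: dc_step_val.
- exact: dc_val_equiv.
- exact: dc_add_val.
- exact: dc_add_ex.
- have d0 : 0 \in Db b by rewrite Db_int.
  by exists (exist (fun q => q \in Db b) _ d0, Z); rewrite /dc_val /= (frac_letter0 Z0) addr0.
- move=> [d P].
  (* The periodic part of the opposite is the complement of [P] to beta^l, of value 1 - frac P; the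
     -1 in the first component makes up for this 1. *)
  have d1 : - val d - 1 \in Db b by apply: Db_add (Db_opp (valP d)) _; rewrite Db_int.
  have [|P' lP NP] := @word_ex (len P) (b ^ len P - 1 - N P) (len_gt0 P).
    by have := N_lt P; lia.
  exists (exist (fun q => q \in Db b) _ d1, P'); rewrite /dc_val /=.
  suff -> : frac P' = 1 - frac P by ring.
  apply: frac_num; rewrite lP mulrBl mul1r fracM NP -subnDA.
  by have := N_lt P => lt; rewrite natrB ?natrD ?natrX /modulus; [ring|lia].
Qed.

End Words.

Theorem theorem6 (b : nat) (hb : (2 <= b)%N) :
  (exists add : Q_WCP b -> Q_WCP b -> Q_WCP b,
     induced_by (@wcp_add b) add /\ abelian_group add) /\
  (exists add : Q_DC b -> Q_DC b -> Q_DC b,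
     induced_by (@dc_add b) add /\ abelian_group add).
Proof. by split; [exact: wcp_group | exact: dc_group]. Qed.
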